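(* Let $a$ be a nonzero real number. For all $m_1,m_2,m_3\in\mathbb{N}$, the functions $$u=\cos at\sum_{\alpha\in\mathbb{N}^{11}}\zeta_{|\alpha|_1,0}(t)\,d_\alpha(x^{m_1}y^{m_2}z^{m_3})-\sin at\sum_{\alpha\in\mathbb{N}^{11}}\zeta_{|\alpha|_1,1}(t)\,d_\alpha(x^{m_1}y^{m_2}z^{m_3})$$ and $$u=\sin at\sum_{\alpha\in\mathbb{N}^{11}}\zeta_{|\alpha|_1,0}(t)\,d_\alpha(x^{m_1}y^{m_2}z^{m_3})+\cos at\sum_{\alpha\in\mathbb{N}^{11}}\zeta_{|\alpha|_1,1}(t)\,d_\alpha(x^{m_1}y^{m_2}z^{m_3})$$ are real solutions of the equation $$u_{tt}-u_{xx}-xu_{yy}-yu_{zz}+a^2u=0.$$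
   Context: $\mathbb{N}$ is the set of nonnegative integers. For a nonzero complex number $b$ and $i\in\mathbb{N}$ define the polynomial $\xi_{b,i}(t)$ by $\xi_{b,0}(t)=1$, $\xi_{b,1}(t)=\frac{t}{b}$, and for $i\ge2$ $$\xi_{b,i}(t)=\frac{t^i}{i!\,b^i}-\frac{t^{i-1}}{(i-2)!\,b^{i+1}}+\sum_{r=2}^{i-1}\frac{(-1)^r\prod_{s=1}^{r-1}(i+s)}{(i-r-1)!\,r!\,b^{r+i}}\,t^{i-r}.$$ For $i\in\mathbb{N}$ write $\xi_{2a\sqrt{-1},i}(t)=\zeta_{i,0}(t)+\zeta_{i,1}(t)\sqrt{-1}$ with $\zeta_{i,0}(t),\zeta_{i,1}(t)$ real functions of the real variable $t$. For $\alpha=(\alpha_1,\dots,\alpha_{11})\in\mathbb{N}^{11}$ set $$|\alpha|_1=\sum_{i=1}^7 i\alpha_i+\alpha_8+2\alpha_9+3\alpha_{10}+\alpha_{11},\qquad \alpha!=\prod_{i=1}^{11}\alpha_i!,$$ and define the differential operator $$d_\alpha=\frac{|\alpha|_1!}{\alpha!}\,2^{-\alpha_4}\,3^{-\alpha_3-\alpha_4-\alpha_5-2\alpha_6-\alpha_7-\alpha_{10}}\,7^{-\alpha_7}\,x^{\alpha_8+\alpha_9+\alpha_{10}}\,y^{\alpha_{11}}\,\partial_x^{2\alpha_1+\alpha_2}\,\partial_y^{2(\alpha_2+\alpha_5+\alpha_8)+\alpha_6+\alpha_9}$$ $$\qquad\times\ \partial_z^{2(2\alpha_5+3\alpha_6+4\alpha_7+\alpha_9+2\alpha_{10}+\alpha_{11})}\,(\partial_y^4+2\partial_x\partial_y\partial_z^2)^{\alpha_3}\,(3\partial_y^3\partial_z^2+\partial_x\partial_z^4)^{\alpha_4}.$$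 For each fixed $m_1,m_2,m_3$ only finitely many $d_\alpha(x^{m_1}y^{m_2}z^{m_3})$ are nonzero.
   Formalization: In d_α the exponent of 3 is corrected from −α_7 to −2α_7 (the factor per unit of α_7 is 1/63, not 1/21); as printed, the claim fails e.g. for (m_1,m_2,m_3)=(0,0,8), and for m_3≤7 the two versions agree. *)

(* Defs.v *)
From HB Require Import structures.
From mathcomp Require Import all_boot all_order all_algebra complex.
From mathcomp Require Import all_classical all_reals all_analysis.

Set Implicit Arguments.
Unset Strict Implicit.
Unset Printing Implicit Defensive.

Import Order.TTheory GRing.Theory Num.Theory.
Import numFieldNormedType.Exports.

Local Open Scope classical_set_scope.
Local Open Scope ring_scope.

Section Xi.
Variable R : realType.
Local Notation C := (complex R).

(* The truncated subtractions are exact on the ranges where they occur. *)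
Definition xi (b : C) (i : nat) : {poly C} :=
  match i with
  | 0 => 1
  | 1 => b^-1 *: 'X
  | _ => (i`!%:R * b ^+ i)^-1 *: 'X^i
         - ((i - 2)`!%:R * b ^+ i.+1)^-1 *: 'X^(i.-1)
         + \sum_(2 <= r < i)
             ((-1) ^+ r * \prod_(1 <= s < r) (i + s)%:R
              / ((i - r - 1)`!%:R * r`!%:R * b ^+ (r + i))) *: 'X^(i - r)
  end.

Definition xi_2ai (a : R) (i : nat) (t : R) : C :=
  (xi (Complex 0 (2 * a)) i).[Complex t 0].

Definition zeta0 (a : R) (i : nat) (t : R) : R := complex.Re (xi_2ai a i t).
Definition zeta1 (a : R) (i : nat) (t : R) : R := complex.Im (xi_2ai a i t).

End Xi.

Definition multiindex := {ffun 'I_11 -> nat}.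

(* Components are numbered from 1 to 11. *)
Definition component (alpha : multiindex) (k : nat) : nat := alpha (inord k.-1).

Definition weight (alpha : multiindex) : nat :=
  (\sum_(1 <= i < 8) i * component alpha i
   + component alpha 8 + 2 * component alpha 9 + 3 * component alpha 10 + component alpha 11)%N.

Definition multifact (alpha : multiindex) : nat :=
  (\prod_(i < 11) (alpha i)`!)%N.

Section Operators.
Variable R : realType.
Implicit Types (f : R -> R -> R -> R) (x y z : R) (n : nat).

Definition dx f : R -> R -> R -> R := fun x y z => derive1 (fun s => f s y z) x.
Definition dy f : R -> R -> R -> R := fun x y z => derive1 (fun s => f x s z) y.
Definition dz f : R -> R -> R -> R := fun x y z => derive1 (fun s => f x y s) z.

Definition dxn n := iter n dx.
Definition dyn n := iter n dy.
Definition dzn n := iter n dz.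

Definition op3 f : R -> R -> R -> R :=
  fun x y z => dyn 4 f x y z + 2 * dx (dy (dzn 2 f)) x y z.

Definition op4 f : R -> R -> R -> R :=
  fun x y z => 3 * dyn 3 (dzn 2 f) x y z + dx (dzn 4 f) x y z.

(* With p, q, r the symbols of the derivatives in x, y, z, the function
   exp (A(t) + x B(t) + y C(t) + z r) where
     C = q + r^2 t,
     B = p + q^2 t + q r^2 t^2 + r^4 t^3 / 3,
     A = p^2 t + p q^2 t^2 + (q^4 + 2 p q r^2) t^3 / 3
         + (3 q^3 r^2 + p r^4) t^4 / 6 + q^2 r^4 t^5 / 3
         + q r^6 t^6 / 9 + r^8 t^7 / 63
   solves v_t = v_xx + x v_yy + y v_zz.  The constant in [dalpha] collects these
   coefficients; in particular 1/63 contributes 3^-2 7^-1 per unit of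
   [component alpha 7]. *)
Definition dalpha (alpha : multiindex) f : R -> R -> R -> R :=
  let a := component alpha in
  fun x y z =>
    (weight alpha)`!%:R / (multifact alpha)%:R
    * 2 ^- (a 4)
    * 3 ^- (a 3 + a 4 + a 5 + 2 * a 6 + 2 * a 7 + a 10)
    * 7 ^- (a 7)
    * x ^+ (a 8 + a 9 + a 10) * y ^+ (a 11)
    * dxn (2 * a 1 + a 2)
       (dyn (2 * (a 2 + a 5 + a 8) + a 6 + a 9)
         (dzn (2 * (2 * a 5 + 3 * a 6 + 4 * a 7 + a 9 + 2 * a 10 + a 11))
           (iter (a 3) op3 (iter (a 4) op4 f)))) x y z.

Definition monomial (m1 m2 m3 : nat) : R -> R -> R -> R :=
  fun x y z => x ^+ m1 * y ^+ m2 * z ^+ m3.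

Definition twice_derivable (g : R -> R) : Prop :=
  forall s, derivable g s 1 /\ derivable (derive1 g) s 1.

(* u_tt - u_xx - x u_yy - y u_zz + a^2 u = 0 on the whole of R^4; since [derive1]
   is total, existence of the derivatives is required separately. *)
Definition is_solution (a : R) (u : R -> R -> R -> R -> R) : Prop :=
  forall t x y z,
    [/\ twice_derivable (fun s => u s x y z),
        twice_derivable (fun s => u t s y z),
        twice_derivable (fun s => u t x s z),
        twice_derivable (fun s => u t x y s)
      & derive1n 2 (fun s => u s x y z) t
        - derive1n 2 (fun s => u t s y z) x
        - x * derive1n 2 (fun s => u t x s z) y
        - y * derive1n 2 (fun s => u t x y s) z
        + a ^+ 2 * u t x y z = 0].

End Operators.

(* Main.v *)
(** Writing the solution as exp(i a t) v, the equation becomes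
    v_tt + 2 a i v_t = L v with L = d_x^2 + x d_y^2 + y d_z^2.  The polynomials xi_i,
    for b = 2 a i, satisfy xi_0 = 1 and xi_(i+1)'' + b xi_(i+1)' = xi_i, so
    v = sum_i xi_i(t) L^i m solves it.  The operators d_alpha with |alpha| = n add
    up to L^n, because they are n! times the coefficient of t^n in the explicit
    formula for exp(t L).  This is proved without identifying L^n: the reindexing
    alpha |-> alpha + e_i expresses v_x, v_y and sum_alpha |alpha| (...) through the
    same sums with shifted weights, and the equation reduces to finitely many
    identities between the symbols of the eleven generators. *)

Require Import Defs.
From mathcomp Require Import all_boot all_order all_algebra complex.
From mathcomp Require Import all_classical all_reals all_analysis.
From mathcomp Require Import ring zify.
Import Order.TTheory GRing.Theory Num.Theory.
Import numFieldNormedType.Exports.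
Local Open Scope classical_set_scope.
Local Open Scope ring_scope.

(** * The functions xi *)

Section XiRecurrence.
Variable R : realType.
Local Notation C := (complex R).
Implicit Types (b : C) (i k : nat).

(* The terms r = 0 and r = 1 that [xi] singles out follow the general pattern,
   because prod_(1 <= s < r) (i + s) = (i + r - 1)! / i!; for r = 0 this quotient
   is 1 / i. *)
Definition xi_coef b i r : C :=
  (-1) ^+ r * (i + r).-1`!%:R
  / (i`!%:R * (i - r).-1`!%:R * r`!%:R * b ^+ (i + r)).

Lemma natr_neq0 n : (0 < n)%N -> n%:R != 0 :> C.
Proof. by rewrite pnatr_eq0 -lt0n. Qed.

Lemma factr_neq0 n : n`!%:R != 0 :> C.
Proof. exact/natr_neq0/fact_gt0. Qed.

Lemma prod_fact i r : (0 < r)%N ->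
  (\prod_(1 <= s < r) (i + s)%:R * i`!%:R = (i + r).-1`!%:R :> C).
Proof.
case: r => // r _; elim: r => [|r IH]; first by rewrite big_geq // mul1r addn1.
rewrite big_nat_recr //= mulrAC IH !addnS /= factS natrM; ring.
Qed.

Lemma xiE b i : b != 0 -> (0 < i)%N ->
  xi b i = \sum_(0 <= r < i) xi_coef b i r *: 'X^(i - r).
Proof.
move=> b0; case: i => [|[|i]] // _.
  rewrite big_nat1 /xi /xi_coef subn0 addn0 !expr1 expr0 /=.
  by rewrite !mul1r.
(* The terms r = 0 and r = 1 are split off and compared with the two leading terms of [xi]. *)
rewrite big_nat_recl // big_nat_recl // /xi.
rewrite addrA; congr (_ + _); first congr (_ + _).
- rewrite /xi_coef subn0 addn0 expr0 !mul1r /= mulr1; congr (_ *: _).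
  have h1 := factr_neq0 i.+1; have h2 := factr_neq0 i.+2.
  move: (b ^+ i.+2) (expf_neq0 i.+2 b0) => B hB.
  by field; rewrite hB h1 h2.
- rewrite /xi_coef -scaleNr expr1 subn1 addn1 /= mulr1 subn2; congr (_ *: _).
  have h1 := factr_neq0 i; have h2 := factr_neq0 i.+2.
  move: (b ^+ i.+3) (expf_neq0 i.+3 b0) => B hB.
  by field; rewrite hB h1 h2.
- rewrite -[in LHS](addn2 0%N) -(addn2 i) big_addn addnK.
  apply: eq_big_nat => r /andP[_ ri].
  rewrite addn2 /xi_coef; congr (_ *: _).
  rewrite -(@prod_fact (i + 2) r.+2) // subn1 (addnC (i + 2)%N).
  have h1 := factr_neq0 (i + 2); have h2 := factr_neq0 r.+2.
  have h3 := factr_neq0 (i + 2 - r.+2).-1.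
  move: (b ^+ _) (expf_neq0 (r.+2 + (i + 2)) b0) => B hB.
  by field; rewrite hB h1 h2 h3.
Qed.

Lemma coef_xi b i k : b != 0 -> (0 < i)%N ->
  (xi b i)`_k = if (0 < k <= i)%N then xi_coef b i (i - k) else 0.
Proof.
move=> b0 i0; rewrite xiE // coef_sum.
case: ifPn => [/andP[k0 ki]|hk].
  rewrite (big_cat_nat (n := (i - k)%N)) //=; last by rewrite leq_subr.
  rewrite [X in _ + X]big_ltn; last by lia.
  rewrite big_nat big1 ?add0r => [|r /andP[_ hr]]; last first.
    by rewrite coefZ coefXn; case: eqP => [?|]; [lia|rewrite mulr0].
  rewrite big_nat big1 ?addr0 => [|r /andP[h1 hr]]; last first.
    by rewrite coefZ coefXn; case: eqP => [?|]; [lia|rewrite mulr0].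
  by rewrite coefZ coefXn subKn // eqxx mulr1.
rewrite big_nat big1 // => r /andP[_ hr].
rewrite coefZ coefXn; case: eqP => [e|]; last by rewrite mulr0.
by move: hk; rewrite e; lia.
Qed.

(** This is the coefficient of X^(k+1) in [xi_ode] with i = k + r + 2. Clearing common factors
    leaves (k+3)(r+1) - (k+2r+3)(k+2) = -(k+r+3)(k+1). *)
Lemma xi_coef_rec b k r : b != 0 ->
  xi_coef b (k + r).+3 r * k.+3%:R * k.+2%:R
    + b * (xi_coef b (k + r).+3 r.+1 * k.+2%:R) = xi_coef b (k + r).+2 r.+1.
Proof.
move=> b0; rewrite /xi_coef.
have -> : ((k + r).+3 - r).-1 = k.+2 by lia.
have -> : ((k + r).+3 - r.+1).-1 = k.+1 by lia.
have -> : ((k + r).+2 - r.+1).-1 = k by lia.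
have -> : ((k + r).+3 + r.+1).-1 = ((k + r).+2 + r).+1 by lia.
have -> : ((k + r).+2 + r.+1).-1 = ((k + r).+2 + r)%N by lia.
have -> : ((k + r).+3 + r).-1 = ((k + r).+2 + r)%N by lia.
have -> : ((k + r).+3 + r = ((k + r).+2 + r).+1)%N by lia.
have -> : ((k + r).+3 + r.+1 = ((k + r).+2 + r).+2)%N by lia.
have -> : ((k + r).+2 + r.+1 = ((k + r).+2 + r).+1)%N by lia.
(* Only m + 1 and n + 1 are needed in terms of k and r; the factorials and b^m become free
   variables. *)
move Em: ((k + r).+2 + r)%N => m; move En: (k + r).+2 => n.
rewrite (factS m) (factS k.+1) (factS k) (factS n) (factS r).
rewrite !natrM !exprS.
have h1 : k%:R + 1 != 0 :> C by rewrite -(natrD _ k 1) addn1 natr_neq0.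
have h2 : k%:R + 2 != 0 :> C by rewrite -natrD addn2 natr_neq0.
have h3 : r%:R + 1 != 0 :> C by rewrite -(natrD _ r 1) addn1 natr_neq0.
have h4 : k%:R + r%:R + 3 != 0 :> C by rewrite -!natrD addn3 natr_neq0.
have -> : k.+1%:R = k%:R + 1 :> C by rewrite -addn1 natrD.
have -> : k.+2%:R = k%:R + 2 :> C by rewrite -addn2 natrD.
have -> : k.+3%:R = k%:R + 3 :> C by rewrite -addn3 natrD.
have -> : r.+1%:R = r%:R + 1 :> C by rewrite -addn1 natrD.
have -> : n.+1%:R = k%:R + r%:R + 3 :> C by rewrite -En -addn3 !natrD.
have -> : m.+1%:R = k%:R + 2 * r%:R + 3 :> C.
  by rewrite -Em -[_.+1]/((k + r).+3 + r)%N -addn3 !natrD; ring.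
have := factr_neq0 k; have := factr_neq0 r; have := factr_neq0 n.
have := expf_neq0 m b0.
move: (k`!%:R) (r`!%:R) (n`!%:R) (m`!%:R) (b ^+ m).
move: ((-1) ^+ r) (k%:R) (r%:R) h1 h2 h3 h4.
move=> s K L h1 h2 h3 h4 G H J F B hB hJ hH hG.
by field; rewrite b0 h1 h2 h3 h4 hB hJ hH hG.
Qed.

(** Coefficients are compared: [xi_coef_rec] covers the generic degrees, while the constant and
    leading ones are computed directly. *)
Lemma xi_ode b i : b != 0 ->
  (xi b i.+1)^`()^`() + b *: (xi b i.+1)^`() = xi b i.
Proof.
(* Index 0 is separate: [xi b 0] has a constant term, so [coef_xi] does not cover it. *)
move=> b0; case: i => [|i].
  rewrite /xi derivZ derivX scalerA mulfV // scale1r.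
  by rewrite -[b^-1 *: 1]mul_polyC mulr1 derivC add0r.
have dE (p : {poly C}) j : p^`()`_j = p`_j.+1 * j.+1%:R.
  by rewrite coef_deriv mulr_natr.
apply/polyP => k; rewrite coefD coefZ !dE !coef_xi //.
have [ik|ki|<-] := ltngtP i.+1 k.
- have -> : (k.+2 <= i.+2)%N = false by lia.
  have -> : (k.+1 <= i.+2)%N = false by lia.
  by rewrite !andbF !mul0r mulr0 addr0.
- case: k ki => [_|k].
    (* Constant term: the right-hand side has none, and the two contributions on the left cancel
       because m + 1 = 2(i + 1). *)
    rewrite /= subn2 subn1 /= /xi_coef subSnn.
    have -> : (i.+2 - i).-1 = 1%N by rewrite !subSn // subnn.
    rewrite addnS /=; move Em: (i.+1 + i)%N => m.
    have -> : (i.+2 + i)%N = m.+1 by rewrite -Em addSn.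
    move En: i.+2 => n.
    rewrite (factS m) (factS i) !natrM !exprS.
    have -> : m.+1%:R = 2 * i.+1%:R :> C by rewrite -natrM -Em mul2n -addnn addnS.
    have := factr_neq0 i; have := factr_neq0 n; have := expf_neq0 m b0.
    have := natr_neq0 _ (ltn0Sn i).
    move: (i`!%:R) (n`!%:R) (m`!%:R) (b ^+ m) (i.+1%:R) ((-1) ^+ i).
    move=> G H J B I s hI hB hH hG.
    by field; rewrite b0 hI hB hG hH.
  rewrite ltnS => ki; have [r ->] : exists r, i = (k + r).+1.
    by exists (i - k.+1)%N; lia.
  rewrite !ltnS leq_addr (leqW (leq_addr _ _)) /=.
  have -> : ((k + r).+3 - k.+3 = r)%N by rewrite !subSS addKn.
  have -> : ((k + r).+3 - k.+2 = r.+1)%N by rewrite !subSS -addnS addKn.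
  have -> : ((k + r).+2 - k.+1 = r.+1)%N by rewrite !subSS -addnS addKn.
  exact: xi_coef_rec.
- rewrite /= ltnn ltnSn !subnn !mul0r add0r /xi_coef.
  rewrite !addn0 !subn0 !expr0 /= exprS (factS i.+1) (factS i) !natrM.
  have := factr_neq0 i; have := expf_neq0 i.+1 b0.
  have := natr_neq0 _ (ltn0Sn i); have := natr_neq0 _ (ltn0Sn i.+1).
  move: (i`!%:R) (b ^+ i.+1) (i.+1%:R) (i.+2%:R) => G B I J hI hJ hB hG.
  rewrite fact0; by field; rewrite b0 hI hJ hB hG.
Qed.

Lemma xi0_deriv b : (xi b 0)^`() = 0.
Proof. by rewrite -[xi b 0]/1 derivC. Qed.

(** * Real and imaginary parts along the real axis *)

Lemma Re_add (u v : C) : complex.Re (u + v) = complex.Re u + complex.Re v.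
Proof. by case: u v => [? ?] []. Qed.

Lemma Im_add (u v : C) : complex.Im (u + v) = complex.Im u + complex.Im v.
Proof. by case: u v => [? ?] []. Qed.

Lemma Re_mulr (u : C) (s : R) :
  complex.Re (u * Complex s 0) = complex.Re u * s.
Proof. by case: u => x y /=; rewrite mulr0 subr0. Qed.

Lemma Im_mulr (u : C) (s : R) :
  complex.Im (u * Complex s 0) = complex.Im u * s.
Proof. by case: u => x y /=; rewrite mulr0 add0r. Qed.

(** Horner induction works componentwise, since multiplying by a real argument scales both parts. *)
Lemma is_derive_ReIm_horner (p : {poly C}) (t : R) :
  is_derive t 1 (fun s => complex.Re p.[Complex s 0])
    (complex.Re p^`().[Complex t 0]) /\
  is_derive t 1 (fun s => complex.Im p.[Complex s 0])
    (complex.Im p^`().[Complex t 0]).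
Proof.
elim/poly_ind: p => [|p c [IHr IHi]].
  by rewrite deriv0; split; under eq_fun do rewrite horner0;
    rewrite horner0; exact: is_derive_cst.
rewrite derivD derivC addr0 derivM derivX mulr1 hornerD hornerMX.
split; [rewrite Re_add Re_mulr|rewrite Im_add Im_mulr];
  under eq_fun do rewrite hornerMXaddC ?(Re_add, Re_mulr) ?(Im_add, Im_mulr).
  by apply: is_derive_eq; rewrite /GRing.scale /=; ring.
by apply: is_derive_eq; rewrite /GRing.scale /=; ring.
Qed.

(* The real and imaginary parts of xi'' + 2 a i xi' = xi_{i-1}. *)
Lemma zeta_ode (a : R) : a != 0 ->
  exists dz0 ddz0 dz1 ddz1 : nat -> R -> R,
  [/\ forall i (t : R), is_derive t 1 (zeta0 a i) (dz0 i t) /\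
                        is_derive t 1 (dz0 i) (ddz0 i t),
      forall i (t : R), is_derive t 1 (zeta1 a i) (dz1 i t) /\
                        is_derive t 1 (dz1 i) (ddz1 i t),
      forall i t, ddz0 i t - 2 * a * dz1 i t
                  = if i is k.+1 then zeta0 a k t else 0
    & forall i t, ddz1 i t + 2 * a * dz0 i t
                  = if i is k.+1 then zeta1 a k t else 0].
Proof.
move=> a0; pose b : C := Complex 0 (2 * a).
have b0 : b != 0 by rewrite eq_complex /= eqxx /= mulf_neq0 // pnatr_eq0.
exists (fun i t => complex.Re (xi b i)^`().[Complex t 0]),
       (fun i t => complex.Re (xi b i)^`()^`().[Complex t 0]),
       (fun i t => complex.Im (xi b i)^`().[Complex t 0]),
       (fun i t => complex.Im (xi b i)^`()^`().[Complex t 0]).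
split=> [i t|i t|[|i] t|[|i] t].
- by split; [case: (is_derive_ReIm_horner (xi b i) t)
            |case: (is_derive_ReIm_horner (xi b i)^`() t)].
- by split; [case: (is_derive_ReIm_horner (xi b i) t)
            |case: (is_derive_ReIm_horner (xi b i)^`() t)].
- by rewrite xi0_deriv deriv0 horner0 /= mulr0 subr0.
- rewrite /zeta0 /xi_2ai -/b -(xi_ode b i b0) hornerD hornerZ.
  by case: (_.[_]) (_^`().[_]) => [u v] [u' v'] /=; ring.
- by rewrite xi0_deriv deriv0 horner0 /= mulr0 addr0.
- rewrite /zeta1 /xi_2ai -/b -(xi_ode b i b0) hornerD hornerZ.
  by case: (_.[_]) (_^`().[_]) => [u v] [u' v'] /=; ring.
Qed.

End XiRecurrence.

(** * Derivatives *)

Lemma is_derive_bigsum (R : realType) (I : Type) (r : seq I)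
    (F : I -> R -> R) (dF : I -> R) (x : R) :
  (forall i, is_derive x 1 (F i) (dF i)) ->
  is_derive x 1 (fun s => \sum_(i <- r) F i s) (\sum_(i <- r) dF i).
Proof.
move=> hF; elim: r => [|i r IH].
  by under eq_fun do rewrite big_nil; rewrite big_nil; exact: is_derive_cst.
by under eq_fun do rewrite big_cons; rewrite big_cons; exact: is_deriveD.
Qed.

Lemma is_derive_mulc (R : realType) (f : R -> R) (df c x : R) :
  is_derive x 1 f df -> is_derive x 1 (fun s => f s * c) (df * c).
Proof.
move=> hf; apply: is_derive_eq.
by rewrite /GRing.scale /= mulr0 add0r mulrC.
Qed.

Lemma is_derive_cmul (R : realType) (f : R -> R) (df c x : R) :
  is_derive x 1 f df -> is_derive x 1 (fun s => c * f s) (c * df).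
Proof. by move=> hf; rewrite -[c * df]/(c *: df); exact: is_deriveZ. Qed.

Lemma is_derive_exprn (R : realType) n (x : R) :
  is_derive x 1 (fun s => s ^+ n) (n%:R * x ^+ n.-1).
Proof.
apply: DeriveDef; first exact: exprn_derivable.
by rewrite exp_derive /GRing.scale /= mulr1.
Qed.

Lemma is_derive_mul (R : realType) (f g : R -> R) (df dg x : R) :
  is_derive x 1 f df -> is_derive x 1 g dg ->
  is_derive x 1 (fun s => f s * g s) (df * g x + f x * dg).
Proof.
move=> hf hg; apply: (is_derive_eq (is_deriveM hf hg)).
by rewrite /GRing.scale /=; ring.
Qed.

Lemma second_derivative (R : realType) (f df ddf : R -> R) :
  (forall x : R, is_derive x 1 f (df x)) -> (forall x : R, is_derive x 1 df (ddf x)) ->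
  twice_derivable f /\ forall x, derive1n 2 f x = ddf x.
Proof.
move=> hf hdf.
have fE : derive1 f = df.
  by apply/funext => x; rewrite derive1E; exact: derive_val.
split=> x; last by rewrite derive1nS derive1n1 fE derive1E; exact: derive_val.
by rewrite fE; split; exact: ex_derive.
Qed.

(** * Sums over multi-indices *)

Definition incr (i : 'I_11) (alpha : multiindex) : multiindex :=
  [ffun j => (alpha j + (j == i))%N].

(** The weight and the exponents of x and y are all linear forms in alpha, so one shift rule serves
    them all. *)
Definition lin (c : seq nat) (alpha : multiindex) : nat :=
  (\sum_(i < 11) nth 0 c i * alpha i)%N.

Lemma lin_incr c i alpha : lin c (incr i alpha) = (lin c alpha + nth 0 c i)%N.
Proof.
rewrite /lin (eq_bigr (fun j : 'I_11 => nth 0 c j * alpha j + nth 0 c j * (j == i))%N).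
  rewrite big_split /=; congr (_ + _)%N.
  rewrite (bigD1 i) //= eqxx muln1 big1 ?addn0 // => j /negbTE ->.
  by rewrite muln0.
by move=> j _; rewrite ffunE mulnDr.
Qed.

Definition box (N : nat) : set multiindex :=
  [set alpha | forall i, (alpha i <= N)%N].

Lemma finite_box N : finite_set (box N).
Proof.
pose emb (f : {ffun 'I_11 -> 'I_N.+1}) : multiindex := [ffun i => f i : nat].
apply: (@sub_finite_set _ _ (emb @` setT)); last exact/finite_image/finite_finset.
move=> alpha hN; exists [ffun i => inord (alpha i)] => //.
by apply/ffunP => i; rewrite !ffunE inordK // ltnS.
Qed.

(** [F] takes the index twice: as a number, on which table lookups compute, and as an ordinal, which
    becomes the [inord k] of [component]. *)
Lemma big_ord_inord (T : Type) (idx : T) (op : T -> T -> T) n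
    (F : nat -> 'I_n.+1 -> T) :
  \big[op/idx]_(i < n.+1) F i i = \big[op/idx]_(0 <= k < n.+1) F k (inord k).
Proof. by rewrite big_mkord; apply: eq_bigr => i _; rewrite inord_val. Qed.

(* The eleven generators of the exponential series: exponents of t, x and y here,
   rational coefficients in [gens_coef], symbols in [gens]. *)
Definition wt : seq nat := [:: 1; 2; 3; 4; 5; 6; 7; 1; 2; 3; 1]%N.
Definition xdeg : seq nat := [:: 0; 0; 0; 0; 0; 0; 0; 1; 1; 1; 0]%N.
Definition ydeg : seq nat := [:: 0; 0; 0; 0; 0; 0; 0; 0; 0; 0; 1]%N.

Lemma lin_wt alpha : lin wt alpha = weight alpha.
Proof.
rewrite /lin (big_ord_inord _ _ _ 10 (fun k i => nth 0 wt k * alpha i)%N) unlock /=.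
by rewrite /weight unlock /= /component /=; lia.
Qed.

Lemma lin_xdeg alpha :
  lin xdeg alpha = (component alpha 8 + component alpha 9 + component alpha 10)%N.
Proof.
rewrite /lin (big_ord_inord _ _ _ 10 (fun k i => nth 0 xdeg k * alpha i)%N) unlock /=.
by rewrite /component /=; lia.
Qed.

Lemma lin_ydeg alpha : lin ydeg alpha = component alpha 11.
Proof.
rewrite /lin (big_ord_inord _ _ _ 10 (fun k i => nth 0 ydeg k * alpha i)%N) unlock /=.
by rewrite /component /=; lia.
Qed.

(** * The operator series *)

(* The symbol calculus is kept over an abstract ring [A]: with the concrete
   polynomial ring, unification would unfold the polynomial operations. *)
Section Expansion.
Variables (R : realType) (A : comNzRingType) (p q r : A).

(** Powers of the ideal (p, q, r) replace the notion of order, as [A] carries no degree; a power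
    above m1 + m2 + m3 annihilates the monomial. *)
Inductive ideal_pow : nat -> A -> Prop :=
| IdealPow0 P : ideal_pow 0 P
| IdealPowS n P Q S : ideal_pow n P -> ideal_pow n Q -> ideal_pow n S ->
    ideal_pow n.+1 (p * P + q * Q + r * S).

Lemma ideal_powM n P Q : ideal_pow n P -> ideal_pow n (P * Q).
Proof.
elim=> {n P} [P|n P1 P2 P3 _ I1 _ I2 _ I3]; first exact: IdealPow0.
by rewrite !mulrDl -!mulrA; apply: IdealPowS.
Qed.

Lemma ideal_pow_lin n P Q1 Q2 Q3 : ideal_pow n P ->
  ideal_pow n.+1 ((p * Q1 + q * Q2 + r * Q3) * P).
Proof.
move=> hP; rewrite !mulrDl -!mulrA ![_ * P]mulrC.
by apply: IdealPowS; exact: ideal_powM.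
Qed.

Definition gens_coef : seq R :=
  [:: 1; 1; 3^-1; 2^-1 * 3^-1; 3^-1; 3^-2; 3^-2 * 7^-1; 1; 1; 3^-1; 1].
Definition gens : seq A :=
  [:: p ^+ 2; p * q ^+ 2; q ^+ 4 + 2 * (p * (q * r ^+ 2));
      3 * (q ^+ 3 * r ^+ 2) + p * r ^+ 4; q ^+ 2 * r ^+ 4;
      q * r ^+ 6; r ^+ 8; q ^+ 2; q * r ^+ 2; r ^+ 4; r ^+ 2].

Definition term_coef (alpha : multiindex) : R :=
  \prod_(i < 11) (gens_coef`_i ^+ alpha i / (alpha i)`!%:R).
Definition term_sym (alpha : multiindex) : A :=
  \prod_(i < 11) nth 0 gens i ^+ alpha i.

(** Coefficientwise form of the rule that exp(g u) has derivative g exp(g u). *)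
Lemma term_coef_incr i alpha :
  (incr i alpha i)%:R * term_coef (incr i alpha) = gens_coef`_i * term_coef alpha.
Proof.
rewrite /term_coef (bigD1 i) //= [in RHS](bigD1 i) //= !mulrA; congr (_ * _).
  rewrite !ffunE eqxx addn1 exprS factS natrM.
  have h1 : (alpha i).+1%:R != 0 :> R by rewrite pnatr_eq0.
  have h2 : (alpha i)`!%:R != 0 :> R by rewrite pnatr_eq0 -lt0n fact_gt0.
  move: (_.+1%:R) (_`!%:R) (_ ^+ _) h1 h2 => a b c h1 h2.
  by field; rewrite h1 h2.
by apply: eq_bigr => j /negbTE ji; rewrite !ffunE ji addn0.
Qed.

Lemma term_sym_incr i alpha : term_sym (incr i alpha) = nth 0 gens i * term_sym alpha.
Proof.
rewrite /term_sym (bigD1 i) //= [in RHS](bigD1 i) //= mulrA; congr (_ * _).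
  by rewrite ffunE eqxx addn1 exprS.
by apply: eq_bigr => j /negbTE ji; rewrite !ffunE ji addn0.
Qed.

(** No generator has a constant term, so each one lies in the ideal (p, q, r). *)
Lemma ideal_pow_gens n i P : (i < 11)%N ->
  ideal_pow n P -> ideal_pow n.+1 (nth 0 gens i * P).
Proof.
move=> hi hP.
suff [Q1 [Q2 [Q3 ->]]] : exists Q1 Q2 Q3,
    nth 0 gens i = p * Q1 + q * Q2 + r * Q3 by exact: ideal_pow_lin.
case: i hi => [|[|[|[|[|[|[|[|[|[|[|]]]]]]]]]]] // _ /=.
- by exists p, 0, 0; ring.
- by exists (q ^+ 2), 0, 0; ring.
- by exists (2 * (q * r ^+ 2)), (q ^+ 3), 0; ring.
- by exists (r ^+ 4), (3 * (q ^+ 2 * r ^+ 2)), 0; ring.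
- by exists 0, (q * r ^+ 4), 0; ring.
- by exists 0, (r ^+ 6), 0; ring.
- by exists 0, 0, (r ^+ 7); ring.
- by exists 0, q, 0; ring.
- by exists 0, (r ^+ 2), 0; ring.
- by exists 0, 0, (r ^+ 3); ring.
- by exists 0, 0, r; ring.
Qed.

(** The factors are nested in the order in which [dalpha] composes its operators. *)
Lemma term_symE alpha : let a := component alpha in
  term_sym alpha = p ^+ (2 * a 1 + a 2)%N *
  (q ^+ (2 * (a 2 + a 5 + a 8) + a 6 + a 9)%N *
   (r ^+ (2 * (2 * a 5 + 3 * a 6 + 4 * a 7 + a 9 + 2 * a 10 + a 11))%N *
   ((q ^+ 4 + 2 * (p * (q * r ^+ 2))) ^+ a 3
    * (3 * (q ^+ 3 * r ^+ 2) + p * r ^+ 4) ^+ a 4))).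
Proof.
move=> a; rewrite /term_sym.
rewrite (big_ord_inord _ _ _ 10 (fun k i => nth 0 gens k ^+ alpha i)).
rewrite unlock /= -[alpha (inord 0)]/(a 1%N) -[alpha (inord 1)]/(a 2%N)
  -[alpha (inord 2)]/(a 3%N) -[alpha (inord 3)]/(a 4%N) -[alpha (inord 4)]/(a 5%N)
  -[alpha (inord 5)]/(a 6%N) -[alpha (inord 6)]/(a 7%N) -[alpha (inord 7)]/(a 8%N)
  -[alpha (inord 8)]/(a 9%N) -[alpha (inord 9)]/(a 10%N) -[alpha (inord 10)]/(a 11%N).
move: (a 1%N) (a 2%N) (a 3%N) (a 4%N) (a 5%N) (a 6%N) (a 7%N) (a 8%N) (a 9%N)
  (a 10%N) (a 11%N).
move: (q ^+ 4 + 2 * (p * (q * r ^+ 2))) (3 * (q ^+ 3 * r ^+ 2) + p * r ^+ 4) => u v.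
move=> a1 a2 a3 a4 a5 a6 a7 a8 a9 a10 a11 {a}.
rewrite ![in RHS](mulnDr, mulnA, exprD, exprM) !exprMn.
ring.
Qed.

Lemma term_coefE alpha : let a := component alpha in
  term_coef alpha = ((multifact alpha)%:R)^-1 * 2 ^- (a 4%N)
    * 3 ^- (a 3 + a 4 + a 5 + 2 * a 6 + 2 * a 7 + a 10)%N * 7 ^- (a 7%N).
Proof.
move=> a; rewrite /term_coef big_split /= prodfV -natr_prod.
rewrite -/(multifact alpha) mulrC -!mulrA.
congr (_ * _).
rewrite (big_ord_inord _ _ _ 10 (fun k i => gens_coef`_k ^+ alpha i)).
rewrite unlock /= -[alpha (inord 0)]/(a 1%N) -[alpha (inord 1)]/(a 2%N)
  -[alpha (inord 2)]/(a 3%N) -[alpha (inord 3)]/(a 4%N) -[alpha (inord 4)]/(a 5%N)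
  -[alpha (inord 5)]/(a 6%N) -[alpha (inord 6)]/(a 7%N) -[alpha (inord 7)]/(a 8%N)
  -[alpha (inord 8)]/(a 9%N) -[alpha (inord 9)]/(a 10%N) -[alpha (inord 10)]/(a 11%N).
move: (a 1%N) (a 2%N) (a 3%N) (a 4%N) (a 5%N) (a 6%N) (a 7%N) (a 8%N) (a 9%N)
  (a 10%N) (a 11%N).
(* The coefficients 1/9 and 1/63 account for the exponents 2 * a 6 and 2 * a 7 of 3. *)
rewrite -[3 ^- 2]exprVn.
move=> a1 a2 a3 a4 a5 a6 a7 a8 a9 a10 a11 {a}.
rewrite -!exprVn !expr1n; move: (2^-1) (3^-1) (7^-1) => u v w.
rewrite ![in RHS](exprD, exprM) !exprMn.
ring.
Qed.

(** * Weighted sums applied to the monomial *)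

Variables (m1 m2 m3 : nat) (act : A -> R -> R -> R -> R).
Local Notation N := (m1 + m2 + m3)%N.
(* [act P] is the function P(d/dx, d/dy, d/dz) x^m1 y^m2 z^m3. *)
Hypothesis act1 : act 1 = @monomial R m1 m2 m3.
Hypothesis actD : forall P Q x y z, act (P + Q) x y z = act P x y z + act Q x y z.
Hypothesis is_derive_act_x : forall P (x y z : R),
  is_derive x 1 (fun s => act P s y z) (act (p * P) x y z).
Hypothesis is_derive_act_y : forall P (x y z : R),
  is_derive y 1 (fun s => act P x s z) (act (q * P) x y z).
Hypothesis is_derive_act_z : forall P (x y z : R),
  is_derive z 1 (fun s => act P x y s) (act (r * P) x y z).
Hypothesis act_ideal_pow : forall n P x y z, (N < n)%N -> ideal_pow n P ->
  act P x y z = 0.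

(** If alpha_i exceeds N, the alpha_i copies of generator i already put the symbol in an
    annihilating power of the ideal. *)
Lemma act_term_sym_out P alpha x y z :
  ~ box N alpha -> act (P * term_sym alpha) x y z = 0.
Proof.
move=> /existsNP[i /negP]; rewrite -ltnNge => hi.
apply: (act_ideal_pow (alpha i)) => //.
rewrite /term_sym (bigD1 i) //= mulrCA.
elim: (alpha i) => [|n IH]; first exact: IdealPow0.
by rewrite exprS -mulrA; exact: ideal_pow_gens.
Qed.

Definition wsum (h : multiindex -> R) P x y z : R :=
  \sum_(alpha \in [set: multiindex])
    h alpha * (term_coef alpha * act (P * term_sym alpha) x y z).

(** The finite list does not depend on h, P or the point, so the series can be differentiated term
    by term. *)
Lemma wsum_box h P x y z :
  wsum h P x y z = \sum_(alpha <- finmap.enum_fset (fset_set (box N)))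
    h alpha * (term_coef alpha * act (P * term_sym alpha) x y z).
Proof.
rewrite -fsbig_finite; last exact: finite_box.
rewrite /wsum; apply/esym/fsbig_widen => // alpha [_ hout].
by rewrite /preimage /= act_term_sym_out // !mulr0.
Qed.

(* Reindex along alpha |-> alpha + e_i: the terms with alpha i = 0 vanish. *)
Lemma wsum_shift1 i h P x y z :
  wsum (fun alpha => (alpha i)%:R * h alpha) P x y z =
  gens_coef`_i * wsum (fun alpha => h (incr i alpha)) (nth 0 gens i * P) x y z.
Proof.
rewrite /wsum [RHS]mulr_fsumr.
rewrite -(@fsbig_widen _ _ _ _ [set alpha : multiindex | (0 < alpha i)%N]) //; last first.
  move=> alpha [_ /negP]; rewrite -leqNgt leqn0 => /eqP hi.
  by rewrite /preimage /= hi !mul0r.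
rewrite (reindex_fsbig (incr i) setT); last first.
  split => [alpha _|alpha beta _ _ /ffunP e|beta /= hb].
  - by rewrite /= ffunE eqxx addn1.
  - by apply/ffunP => j; have := e j; rewrite !ffunE => /addIn.
  - exists [ffun j => (beta j - (j == i))%N] => //.
    apply/ffunP => j; rewrite !ffunE subnK //.
    by case: eqP => // ->.
apply: eq_fsbigr => alpha _.
rewrite term_sym_incr (mulrCA P) (mulrA (nth 0 gens i)).
have := term_coef_incr i alpha.
move: (term_coef _) (term_coef _) (act _ _ _ _) => c c' e hc.
move: (h _) (_%:R) hc => u v hc; by rewrite [RHS]mulrCA (mulrA gens_coef`_i) -hc; ring.
Qed.

(** Linear combination of [wsum_shift1] over the eleven directions. *)
Lemma wsum_lin c h P x y z :
  wsum (fun alpha => (lin c alpha)%:R * h alpha) P x y z =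
  \sum_(i < 11) (nth 0%N c i)%:R * (gens_coef`_i *
     wsum (fun alpha => h (incr i alpha)) (nth 0 gens i * P) x y z).
Proof.
under [RHS]eq_bigr do rewrite -wsum_shift1 wsum_box mulr_sumr.
rewrite wsum_box exchange_big /=; apply: eq_bigr => alpha _.
rewrite /lin natr_sum !mulr_suml; apply: eq_bigr => i _.
by rewrite natrM; move: (_ * act _ _ _ _) (h _) => ? ?; ring.
Qed.

Lemma eq_wsum h h' P x y z : h =1 h' -> wsum h P x y z = wsum h' P x y z.
Proof. by move=> /funext ->. Qed.

(* The series obtained from exp (A(t) + x B(t) + y C(t)) by replacing t^n with
   phi n, multiplied by the symbol P and applied to x^m1 y^m2 z^m3. *)
Definition wser (phi : nat -> R) P x y z : R :=
  wsum (fun alpha => phi (lin wt alpha) * x ^+ lin xdeg alpha * y ^+ lin ydeg alpha)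
    P x y z.

(* With phi n standing for t^n, this is multiplication by t^k. *)
Definition delay k (phi : nat -> R) : nat -> R := fun n => phi (n + k)%N.

Lemma wserD phi P Q x y z :
  wser phi (P + Q) x y z = wser phi P x y z + wser phi Q x y z.
Proof.
rewrite /wser !wsum_box -big_split; apply: eq_bigr => alpha _ /=.
by rewrite mulrDl actD !mulrDr.
Qed.

Lemma wser_lin phi phi' c c' P x y z :
  wser (fun n => c * phi n + c' * phi' n) P x y z
  = c * wser phi P x y z + c' * wser phi' P x y z.
Proof.
rewrite /wser !wsum_box [c * _]mulr_sumr [c' * _]mulr_sumr -big_split.
apply: eq_bigr => alpha _ /=.
by move: (_ * act _ _ _ _) (x ^+ _) (y ^+ _) => ? ? ?; ring.
Qed.

Lemma is_derive_wser_t (phi : R -> nat -> R) dphi P x y z (t : R) :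
  (forall n, is_derive t 1 (fun s => phi s n) (dphi n)) ->
  is_derive t 1 (fun s => wser (phi s) P x y z) (wser dphi P x y z).
Proof.
move=> hphi; under eq_fun do rewrite /wser wsum_box.
rewrite /wser wsum_box; apply: is_derive_bigsum => alpha.
by do 3 apply: is_derive_mulc.
Qed.

(** Mirrors the t-derivative of the exponential: a generator g t^w x^d y^e contributes w g t^(w-1)
    x^d y^e, with [delay] for t^(w-1). *)
Lemma wser_weight phi P x y z :
  wser (fun n => n%:R * phi n.-1) P x y z =
  \sum_(i < 11) (nth 0%N wt i)%:R * (gens_coef`_i *
     (x ^+ nth 0%N xdeg i * y ^+ nth 0%N ydeg i *
      wser (delay (nth 0%N wt i).-1 phi) (nth 0 gens i * P) x y z)).
Proof.
rewrite /wser.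
under eq_wsum do rewrite -!mulrA.
rewrite wsum_lin; apply: eq_bigr => i _; congr (_ * (_ * _)).
rewrite !wsum_box [RHS]mulr_sumr; apply: eq_bigr => alpha _.
rewrite !lin_incr !exprD /delay.
(* The predecessor does not truncate here, because every weight is positive. *)
have -> : (lin wt alpha + nth 0%N wt i).-1 = (lin wt alpha + (nth 0%N wt i).-1)%N.
  by case: i => [[|[|[|[|[|[|[|[|[|[|[|]]]]]]]]]]]] //= _; rewrite ?addn0 !addnS ?addn0.
move: (phi _) (_ * act _ _ _ _) (x ^+ lin _ _) (y ^+ lin _ _) => ? ? ? ?.
by move: (x ^+ _) (y ^+ _) => ? ?; ring.
Qed.

Lemma is_derive_wser_z phi P x y (z : R) :
  is_derive z 1 (fun s => wser phi P x y s) (wser phi (r * P) x y z).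
Proof.
under eq_fun do rewrite /wser wsum_box.
rewrite /wser wsum_box; apply: is_derive_bigsum => alpha.
by do 2 apply: is_derive_cmul; rewrite -mulrA; exact: is_derive_act_z.
Qed.

(** Product rule: differentiating [act] gives the factor p, and differentiating the power of x
    brings down [lin xdeg alpha], which [wsum_lin] turns into shifts. *)
Lemma is_derive_wser_x_sum phi P (x : R) y z :
  is_derive x 1 (fun s => wser phi P s y z)
   (wser phi (p * P) x y z + \sum_(i < 11) (nth 0%N xdeg i)%:R * (gens_coef`_i *
       wser (delay (nth 0%N wt i) phi) (nth 0 gens i * P) x y z)).
Proof.
under eq_fun do rewrite /wser wsum_box.
have -> : \sum_(i < 11) (nth 0%N xdeg i)%:R * (gens_coef`_i *
       wser (delay (nth 0%N wt i) phi) (nth 0 gens i * P) x y z)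
   = wsum (fun alpha => (lin xdeg alpha)%:R *
      (phi (lin wt alpha) * x ^+ (lin xdeg alpha).-1 * y ^+ lin ydeg alpha)) P x y z.
  rewrite wsum_lin; apply: eq_bigr => i _.
  (* A generator containing x has degree one in it and no y, so the predecessor removes exactly the
     power that the shift adds. *)
  have : (nth 0 xdeg i == 0) || (nth 0 xdeg i == 1) && (nth 0 ydeg i == 0).
    by case: i => [[|[|[|[|[|[|[|[|[|[|[|]]]]]]]]]]]].
  case/orP => [/eqP ->|/andP[/eqP h1 /eqP h2]]; first by rewrite !mul0r.
  congr (_ * (_ * _)); apply: eq_wsum => alpha.
  by rewrite !lin_incr h1 h2 addn1 addn0.
rewrite /wser !wsum_box -big_split; apply: is_derive_bigsum => alpha /=.
set a := phi _; set b := _ ^+ lin ydeg _.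
have hd := is_derive_mul _ _ _ _ _ _ (is_derive_exprn R (lin xdeg alpha) x)
  (is_derive_act_x (P * term_sym alpha) x y z).
have -> : (fun s => a * s ^+ lin xdeg alpha * b *
        (term_coef alpha * act (P * term_sym alpha) s y z))
  = (fun s => (a * b * term_coef alpha) *
        (s ^+ lin xdeg alpha * act (P * term_sym alpha) s y z)).
  apply/funext => s; move: (act _ _ _ _) (term_coef _) (s ^+ _) => ? ? ?; ring.
apply: (is_derive_eq (is_derive_cmul _ _ _ (a * b * term_coef alpha) _ hd)).
rewrite -[p * P * _]mulrA; move: (act _ _ _ _) (act _ _ _ _) (term_coef _) => ? ? ?.
by move: (x ^+ _) (x ^+ _) (_%:R) => ? ? ?; ring.
Qed.

Lemma is_derive_wser_y_sum phi P x (y : R) z :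
  is_derive y 1 (fun s => wser phi P x s z)
   (wser phi (q * P) x y z + \sum_(i < 11) (nth 0%N ydeg i)%:R * (gens_coef`_i *
       wser (delay (nth 0%N wt i) phi) (nth 0 gens i * P) x y z)).
Proof.
under eq_fun do rewrite /wser wsum_box.
have -> : \sum_(i < 11) (nth 0%N ydeg i)%:R * (gens_coef`_i *
       wser (delay (nth 0%N wt i) phi) (nth 0 gens i * P) x y z)
   = wsum (fun alpha => (lin ydeg alpha)%:R *
      (phi (lin wt alpha) * x ^+ lin xdeg alpha * y ^+ (lin ydeg alpha).-1)) P x y z.
  rewrite wsum_lin; apply: eq_bigr => i _.
  have : (nth 0 ydeg i == 0) || (nth 0 ydeg i == 1) && (nth 0 xdeg i == 0).
    by case: i => [[|[|[|[|[|[|[|[|[|[|[|]]]]]]]]]]]].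
  case/orP => [/eqP ->|/andP[/eqP h1 /eqP h2]]; first by rewrite !mul0r.
  congr (_ * (_ * _)); apply: eq_wsum => alpha.
  by rewrite !lin_incr h1 h2 addn1 addn0.
rewrite /wser !wsum_box -big_split; apply: is_derive_bigsum => alpha /=.
set a := phi _; set b := _ ^+ lin xdeg _.
have hd := is_derive_mul _ _ _ _ _ _ (is_derive_exprn R (lin ydeg alpha) y)
  (is_derive_act_y (P * term_sym alpha) x y z).
have -> : (fun s => a * b * s ^+ lin ydeg alpha *
        (term_coef alpha * act (P * term_sym alpha) x s z))
  = (fun s => (a * b * term_coef alpha) *
        (s ^+ lin ydeg alpha * act (P * term_sym alpha) x s z)).
  apply/funext => s; move: (act _ _ _ _) (term_coef _) (s ^+ _) => ? ? ?; ring.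
apply: (is_derive_eq (is_derive_cmul _ _ _ (a * b * term_coef alpha) _ hd)).
rewrite -[q * P * _]mulrA; move: (act _ _ _ _) (act _ _ _ _) (term_coef _) => ? ? ?.
by move: (y ^+ _) (y ^+ _) (_%:R) => ? ? ?; ring.
Qed.

(** * The operators d_alpha as symbols *)

Lemma dx_act P : dx (act P) = act (p * P).
Proof.
apply/funext => x; apply/funext => y; apply/funext => z.
by rewrite /dx derive1E; apply: derive_val; exact: is_derive_act_x.
Qed.

Lemma dy_act P : dy (act P) = act (q * P).
Proof.
apply/funext => x; apply/funext => y; apply/funext => z.
by rewrite /dy derive1E; apply: derive_val; exact: is_derive_act_y.
Qed.

Lemma dz_act P : dz (act P) = act (r * P).
Proof.
apply/funext => x; apply/funext => y; apply/funext => z.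
by rewrite /dz derive1E; apply: derive_val; exact: is_derive_act_z.
Qed.

Lemma iter_act D s n P : (forall Q, D (act Q) = act (s * Q)) ->
  iter n D (act P) = act (s ^+ n * P).
Proof.
move=> hD; elim: n => [|n IH]; first by rewrite mul1r.
by rewrite iterS IH hD exprS mulrA.
Qed.

Lemma op3_act P : op3 (act P) = act ((q ^+ 4 + 2 * (p * (q * r ^+ 2))) * P).
Proof.
rewrite /op3 /dyn /dzn !(iter_act _ _ _ _ dy_act) !(iter_act _ _ _ _ dz_act).
rewrite dy_act dx_act; apply/funext => x; apply/funext => y; apply/funext => z.
set Q := p * (q * _).
(* The multiple 2Q is written as a sum because [act] is only assumed additive. *)
have -> : (q ^+ 4 + 2 * (p * (q * r ^+ 2))) * P = q ^+ 4 * P + (Q + Q).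
  by rewrite /Q; ring.
by rewrite !actD; ring.
Qed.

Lemma op4_act P : op4 (act P) = act ((3 * (q ^+ 3 * r ^+ 2) + p * r ^+ 4) * P).
Proof.
rewrite /op4 /dyn /dzn !(iter_act _ _ _ _ dz_act) !(iter_act _ _ _ _ dy_act).
rewrite dx_act; apply/funext => x; apply/funext => y; apply/funext => z.
set Q := q ^+ 3 * _; set S := p * (r ^+ 4 * P).
have -> : (3 * (q ^+ 3 * r ^+ 2) + p * r ^+ 4) * P = Q + Q + Q + S.
  by rewrite /Q /S; ring.
by rewrite !actD; ring.
Qed.

Lemma dalphaE alpha x y z :
  dalpha alpha (@monomial R m1 m2 m3) x y z =
  (weight alpha)`!%:R * (x ^+ lin xdeg alpha * y ^+ lin ydeg alpha *
     (term_coef alpha * act (1 * term_sym alpha) x y z)).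
Proof.
rewrite /dalpha -act1 (iter_act _ _ _ _ op4_act) (iter_act _ _ _ _ op3_act).
rewrite /dzn /dyn /dxn (iter_act _ _ _ _ dz_act) (iter_act _ _ _ _ dy_act).
rewrite (iter_act _ _ _ _ dx_act) lin_xdeg lin_ydeg term_coefE mul1r term_symE.
rewrite (mulr1 ((3 * (q ^+ 3 * r ^+ 2) + p * r ^+ 4) ^+ _)).
move: (act _ _ _ _) (_`!%:R) (x ^+ _) (y ^+ _) (2 ^- _) (3 ^- _) (7 ^- _) => *.
by ring.
Qed.

(** The factor |alpha|! inside d_alpha is why t^n is replaced by n! psi(n). *)
Lemma sum_dalphaE (psi : nat -> R) x y z :
  \sum_(alpha \in [set: multiindex])
    psi (weight alpha) * dalpha alpha (@monomial R m1 m2 m3) x y z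
  = wser (fun n => n`!%:R * psi n) 1 x y z.
Proof.
apply: eq_fsbigr => alpha _; rewrite dalphaE lin_wt.
move: (psi _) (_`!%:R) (x ^+ _) (y ^+ _) (_ * act _ _ _ _) => *; ring.
Qed.

(** * Second derivatives and the evolution equation *)

(** Multiplication by B(t) = p + q^2 t + q r^2 t^2 + r^4 t^3 / 3, with [delay k] for t^k; [wser_dy]
    does the same for C(t) = q + r^2 t. *)
Definition wser_dx phi P x y z :=
  wser phi (p * P) x y z + wser (delay 1 phi) (q ^+ 2 * P) x y z
  + wser (delay 2 phi) (q * r ^+ 2 * P) x y z
  + 3^-1 * wser (delay 3 phi) (r ^+ 4 * P) x y z.

Definition wser_dy phi P x y z :=
  wser phi (q * P) x y z + wser (delay 1 phi) (r ^+ 2 * P) x y z.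

Lemma is_derive_wser_dx phi P (x y z : R) :
  is_derive x 1 (fun s => wser phi P s y z) (wser_dx phi P x y z).
Proof.
apply: is_derive_eq (is_derive_wser_x_sum phi P x y z) _.
by rewrite !big_ord_recl big_ord0 /= /wser_dx !mul0r !add0r !addr0 !mul1r -!addrA.
Qed.

Lemma is_derive_wser_dy phi P (x y z : R) :
  is_derive y 1 (fun s => wser phi P x s z) (wser_dy phi P x y z).
Proof.
apply: is_derive_eq (is_derive_wser_y_sum phi P x y z) _.
by rewrite !big_ord_recl big_ord0 /= /wser_dy !mul0r !add0r !addr0 !mul1r.
Qed.

Definition wser_dxx phi P x y z :=
  wser_dx phi (p * P) x y z + wser_dx (delay 1 phi) (q ^+ 2 * P) x y z
  + wser_dx (delay 2 phi) (q * r ^+ 2 * P) x y z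
  + 3^-1 * wser_dx (delay 3 phi) (r ^+ 4 * P) x y z.

Definition wser_dyy phi P x y z :=
  wser_dy phi (q * P) x y z + wser_dy (delay 1 phi) (r ^+ 2 * P) x y z.

Lemma is_derive_wser_dxx phi P (x y z : R) :
  is_derive x 1 (fun s => wser_dx phi P s y z) (wser_dxx phi P x y z).
Proof.
rewrite /wser_dx /wser_dxx.
apply: is_deriveD (is_derive_cmul _ _ _ _ _ (is_derive_wser_dx _ _ _ _ _)).
by do 2 (apply: is_deriveD; last exact: is_derive_wser_dx);
  exact: is_derive_wser_dx.
Qed.

Lemma is_derive_wser_dyy phi P (x y z : R) :
  is_derive y 1 (fun s => wser_dy phi P x s z) (wser_dyy phi P x y z).
Proof. by apply: is_deriveD; exact: is_derive_wser_dy. Qed.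

Lemma delay_delay j k phi : delay j (delay k phi) = delay (j + k) phi.
Proof. by apply/funext => n; rewrite /delay addnA. Qed.

Lemma delay0 phi : delay 0 phi = phi.
Proof. by apply/funext => n; rewrite /delay addn0. Qed.

(* With phi n standing for t^n the left-hand side is the t-derivative of the
   series, so this is v_t = v_xx + x v_yy + y v_zz coefficient by coefficient. *)
Lemma wser_heat phi P x y z :
  wser (fun n => n%:R * phi n.-1) P x y z =
  wser_dxx phi P x y z + x * wser_dyy phi P x y z
    + y * wser phi (r * (r * P)) x y z.
Proof.
rewrite wser_weight !big_ord_recl big_ord0 /= /wser_dxx /wser_dyy /wser_dx /wser_dy.
rewrite !delay_delay !addSn !add0n !delay0 !expr0 !expr1 !mul1r !mulr1.
(* Multiples become repeated sums for [wserD], and each product is put in one normal form so that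
   equal symbols coincide. *)
have -> : (q ^+ 4 + 2 * (p * (q * r ^+ 2))) * P
    = q ^+ 4 * P + (p * q * r ^+ 2 * P + p * q * r ^+ 2 * P).
  by ring.
have -> : (3 * (q ^+ 3 * r ^+ 2) + p * r ^+ 4) * P
    = q ^+ 3 * r ^+ 2 * P + (q ^+ 3 * r ^+ 2 * P + q ^+ 3 * r ^+ 2 * P)
      + p * r ^+ 4 * P.
  by ring.
have -> : p * (p * P) = p ^+ 2 * P by ring.
have -> : q ^+ 2 * (p * P) = p * q ^+ 2 * P by ring.
have -> : p * (q ^+ 2 * P) = p * q ^+ 2 * P by ring.
have -> : q * r ^+ 2 * (p * P) = p * q * r ^+ 2 * P by ring.
have -> : p * (q * r ^+ 2 * P) = p * q * r ^+ 2 * P by ring.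
have -> : r ^+ 4 * (p * P) = p * r ^+ 4 * P by ring.
have -> : p * (r ^+ 4 * P) = p * r ^+ 4 * P by ring.
have -> : q ^+ 2 * (q ^+ 2 * P) = q ^+ 4 * P by ring.
have -> : q ^+ 2 * (q * r ^+ 2 * P) = q ^+ 3 * r ^+ 2 * P by ring.
have -> : q * r ^+ 2 * (q ^+ 2 * P) = q ^+ 3 * r ^+ 2 * P by ring.
have -> : q ^+ 2 * (r ^+ 4 * P) = q ^+ 2 * r ^+ 4 * P by ring.
have -> : r ^+ 4 * (q ^+ 2 * P) = q ^+ 2 * r ^+ 4 * P by ring.
have -> : q * r ^+ 2 * (q * r ^+ 2 * P) = q ^+ 2 * r ^+ 4 * P by ring.
have -> : q * r ^+ 2 * (r ^+ 4 * P) = q * r ^+ 6 * P by ring.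
have -> : r ^+ 4 * (q * r ^+ 2 * P) = q * r ^+ 6 * P by ring.
have -> : r ^+ 4 * (r ^+ 4 * P) = r ^+ 8 * P by ring.
have -> : q * (q * P) = q ^+ 2 * P by ring.
have -> : r ^+ 2 * (q * P) = q * r ^+ 2 * P by ring.
have -> : q * (r ^+ 2 * P) = q * r ^+ 2 * P by ring.
have -> : r ^+ 2 * (r ^+ 2 * P) = r ^+ 4 * P by ring.
have -> : r * (r * P) = r ^+ 2 * P by ring.
by rewrite !wserD; field.
Qed.

(** * From the series to real solutions *)

(** With V0, V1 the two series, u_tt + a^2 u = c (V0'' - 2a V1') + s (V1'' + 2a V0'), and the
    conditions on phi0, phi1 with [wser_heat] turn the brackets into L V0 and L V1. *)
Lemma is_solution_wser (a : R) (c s : R -> R)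
    (phi0 dphi0 ddphi0 phi1 dphi1 ddphi1 : R -> nat -> R) :
  (forall t : R, is_derive t 1 c (a * s t)) ->
  (forall t : R, is_derive t 1 s (- (a * c t))) ->
  (forall n (t : R), is_derive t 1 (phi0^~ n) (dphi0 t n)) ->
  (forall n (t : R), is_derive t 1 (dphi0^~ n) (ddphi0 t n)) ->
  (forall n (t : R), is_derive t 1 (phi1^~ n) (dphi1 t n)) ->
  (forall n (t : R), is_derive t 1 (dphi1^~ n) (ddphi1 t n)) ->
  (forall t n, 1 * ddphi0 t n + - (2 * a) * dphi1 t n = n%:R * phi0 t n.-1) ->
  (forall t n, 1 * ddphi1 t n + 2 * a * dphi0 t n = n%:R * phi1 t n.-1) ->
  is_solution a (fun t x y z =>
    c t * wser (phi0 t) 1 x y z + s t * wser (phi1 t) 1 x y z).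
Proof.
move=> hc hs h0 hd0 h1 hd1 ode0 ode1 t x y z.
pose W f := wser f 1 x y z.
have hW (f df : R -> nat -> R) (u : R) :
    (forall n (t : R), is_derive t 1 (f^~ n) (df t n)) ->
    is_derive u 1 (fun v => W (f v)) (W (df u)).
  by move=> hf; apply: is_derive_wser_t.
(* Both derivatives keep the exact shape that the product rule produces. *)
pose ut v := a * s v * W (phi0 v) + c v * W (dphi0 v)
           + (- (a * c v) * W (phi1 v) + s v * W (dphi1 v)).
pose utt v := a * - (a * c v) * W (phi0 v) + a * s v * W (dphi0 v)
  + (a * s v * W (dphi0 v) + c v * W (ddphi0 v))
  + (- (a * (a * s v)) * W (phi1 v) + - (a * c v) * W (dphi1 v)
     + (- (a * c v) * W (dphi1 v) + s v * W (ddphi1 v))).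
pose u0 v := c v * W (phi0 v) + s v * W (phi1 v).
have [|v|t1 t2] := second_derivative R u0 ut utt.
- by move=> v; apply: is_deriveD; apply: is_derive_mul => //; exact: hW.
- have has := is_derive_cmul _ _ _ a _ (hs v).
  have hnac : is_derive v 1 (fun v => - (a * c v)) (- (a * (a * s v))).
    by apply: is_deriveN; exact: is_derive_cmul.
  by do 2 apply: is_deriveD; apply: is_derive_mul => //; exact: hW.
pose comb (f g : R -> R) v := c t * f v + s t * g v.
have is_derive_comb f g df dg (v : R) : is_derive v 1 f df -> is_derive v 1 g dg ->
    is_derive v 1 (comb f g) (c t * df + s t * dg).
  by move=> hf hg; apply: is_deriveD; exact: is_derive_cmul.
pose ux := comb (fun v => wser (phi0 t) 1 v y z) (fun v => wser (phi1 t) 1 v y z).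
pose dux := comb (fun v => wser_dx (phi0 t) 1 v y z)
  (fun v => wser_dx (phi1 t) 1 v y z).
pose ddux := comb (fun v => wser_dxx (phi0 t) 1 v y z)
  (fun v => wser_dxx (phi1 t) 1 v y z).
have [x1 x2] := second_derivative R ux dux ddux
  (fun v => is_derive_comb _ _ _ _ v (is_derive_wser_dx (phi0 t) 1 v y z)
     (is_derive_wser_dx (phi1 t) 1 v y z))
  (fun v => is_derive_comb _ _ _ _ v (is_derive_wser_dxx (phi0 t) 1 v y z)
     (is_derive_wser_dxx (phi1 t) 1 v y z)).
pose uy := comb (fun v => wser (phi0 t) 1 x v z) (fun v => wser (phi1 t) 1 x v z).
pose duy := comb (fun v => wser_dy (phi0 t) 1 x v z)
  (fun v => wser_dy (phi1 t) 1 x v z).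
pose dduy := comb (fun v => wser_dyy (phi0 t) 1 x v z)
  (fun v => wser_dyy (phi1 t) 1 x v z).
have [y1 y2] := second_derivative R uy duy dduy
  (fun v => is_derive_comb _ _ _ _ v (is_derive_wser_dy (phi0 t) 1 x v z)
     (is_derive_wser_dy (phi1 t) 1 x v z))
  (fun v => is_derive_comb _ _ _ _ v (is_derive_wser_dyy (phi0 t) 1 x v z)
     (is_derive_wser_dyy (phi1 t) 1 x v z)).
pose uz := comb (fun v => wser (phi0 t) 1 x y v) (fun v => wser (phi1 t) 1 x y v).
pose duz := comb (fun v => wser (phi0 t) (r * 1) x y v)
  (fun v => wser (phi1 t) (r * 1) x y v).
pose dduz := comb (fun v => wser (phi0 t) (r * (r * 1)) x y v)
  (fun v => wser (phi1 t) (r * (r * 1)) x y v).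
have [z1 z2] := second_derivative R uz duz dduz
  (fun v => is_derive_comb _ _ _ _ v (is_derive_wser_z (phi0 t) 1 x y v)
     (is_derive_wser_z (phi1 t) 1 x y v))
  (fun v => is_derive_comb _ _ _ _ v (is_derive_wser_z (phi0 t) (r * 1) x y v)
     (is_derive_wser_z (phi1 t) (r * 1) x y v)).
split; [exact: t1|exact: x1|exact: y1|exact: z1|].
rewrite -[LHS]/(derive1n 2 u0 t - derive1n 2 ux x - x * derive1n 2 uy y
  - y * derive1n 2 uz z + a ^+ 2 * u0 t).
rewrite t2 x2 y2 z2 /utt /u0 /ddux /dduy /dduz /comb /W.
have := wser_heat (phi0 t) 1 x y z; rewrite -(funext (ode0 t)) wser_lin => e0.
have := wser_heat (phi1 t) 1 x y z; rewrite -(funext (ode1 t)) wser_lin => e1.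
have {e0}-> : wser (ddphi0 t) 1 x y z = wser_dxx (phi0 t) 1 x y z +
  x * wser_dyy (phi0 t) 1 x y z + y * wser (phi0 t) (r * (r * 1)) x y z
  + 2 * a * wser (dphi1 t) 1 x y z by rewrite -e0; ring.
have {e1}-> : wser (ddphi1 t) 1 x y z = wser_dxx (phi1 t) 1 x y z +
  x * wser_dyy (phi1 t) 1 x y z + y * wser (phi1 t) (r * (r * 1)) x y z
  - 2 * a * wser (dphi0 t) 1 x y z by rewrite -e1; ring.
ring.
Qed.

(** Rescaling z_n to n! z_n turns the source term z_(n-1) into n times the rescaled one, as
    [is_solution_wser] requires. *)
Lemma is_solution_dalpha (a : R) (c s : R -> R)
    (z0 dz0 ddz0 z1 dz1 ddz1 : nat -> R -> R) :
  (forall t : R, is_derive t 1 c (a * s t)) ->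
  (forall t : R, is_derive t 1 s (- (a * c t))) ->
  (forall n (t : R), is_derive t 1 (z0 n) (dz0 n t)) ->
  (forall n (t : R), is_derive t 1 (dz0 n) (ddz0 n t)) ->
  (forall n (t : R), is_derive t 1 (z1 n) (dz1 n t)) ->
  (forall n (t : R), is_derive t 1 (dz1 n) (ddz1 n t)) ->
  (forall n t, ddz0 n t - 2 * a * dz1 n t = if n is k.+1 then z0 k t else 0) ->
  (forall n t, ddz1 n t + 2 * a * dz0 n t = if n is k.+1 then z1 k t else 0) ->
  is_solution a (fun t x y z =>
    c t * (\sum_(alpha \in [set: multiindex])
       z0 (weight alpha) t * dalpha alpha (@monomial R m1 m2 m3) x y z)
    + s t * (\sum_(alpha \in [set: multiindex])
       z1 (weight alpha) t * dalpha alpha (@monomial R m1 m2 m3) x y z)).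
Proof.
move=> hc hs h0 hd0 h1 hd1 ode0 ode1.
pose w (f : nat -> R -> R) (t : R) (n : nat) := n`!%:R * f n t.
have dw (f df : nat -> R -> R) : (forall n (t : R), is_derive t 1 (f n) (df n t)) ->
    forall n (t : R), is_derive t 1 ((w f)^~ n) (w df t n).
  by move=> hf n t; apply: is_derive_cmul.
have wE (f : nat -> R -> R) t n :
    n`!%:R * (if n is k.+1 then f k t else 0) = n%:R * w f t n.-1.
  case: n => [|n]; first by rewrite mulr0 mul0r.
  by rewrite factS natrM -mulrA.
have -> : (fun t x y z =>
    c t * (\sum_(alpha \in [set: multiindex])
       z0 (weight alpha) t * dalpha alpha (@monomial R m1 m2 m3) x y z)
    + s t * (\sum_(alpha \in [set: multiindex])
       z1 (weight alpha) t * dalpha alpha (@monomial R m1 m2 m3) x y z)) =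
  (fun t x y z => c t * wser (w z0 t) 1 x y z + s t * wser (w z1 t) 1 x y z).
  apply/funext => t; apply/funext => x; apply/funext => y; apply/funext => z.
  by rewrite (sum_dalphaE (z0^~ t)) (sum_dalphaE (z1^~ t)).
have o0 t n : 1 * w ddz0 t n + - (2 * a) * w dz1 t n = n%:R * w z0 t n.-1.
  by rewrite -wE -ode0 /w; ring.
have o1 t n : 1 * w ddz1 t n + 2 * a * w dz0 t n = n%:R * w z1 t n.-1.
  by rewrite -wE -ode1 /w; ring.
exact: (is_solution_wser a c s _ _ _ _ _ _ hc hs (dw _ _ h0) (dw _ _ hd0)
  (dw _ _ h1) (dw _ _ hd1) o0 o1).
Qed.

End Expansion.

(** * The ring of symbols *)

Section Symbols.
Variable R : realType.

(* The operator sum_j c_j (d/dx)^j applied to x^m. *)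
Definition dsum (m : nat) (c : nat -> R) (x : R) : R :=
  \sum_(j < m.+1) c j * (m ^_ j)%:R * x ^+ (m - j).

Lemma eq_dsum m c c' x : c =1 c' -> dsum m c x = dsum m c' x.
Proof. by move=> cc'; apply: eq_bigr => j _; rewrite cc'. Qed.

Lemma dsum_eq0 m c x : (forall j, (j <= m)%N -> c j = 0) -> dsum m c x = 0.
Proof. by move=> c0; rewrite /dsum big1 // => j _; rewrite c0 ?mul0r // -ltnS. Qed.

Lemma dsumD m c c' x :
  dsum m (fun j => c j + c' j) x = dsum m c x + dsum m c' x.
Proof. by rewrite /dsum -big_split; apply: eq_bigr => j _ /=; rewrite !mulrDl. Qed.

Lemma dsum_delta m c x : dsum m (fun j => if j == 0%N then c else 0) x = c * x ^+ m.
Proof.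
rewrite /dsum big_ord_recl /= subn0 ffactn0 mulr1 big1 ?addr0 // => j _.
by rewrite !mul0r.
Qed.

(** Differentiation moves each coefficient up one place; the last one drops out since (d/dx)^(m+1)
    kills x^m. *)
Lemma is_derive_dsum m c (x : R) :
  is_derive x 1 (dsum m c)
    (dsum m (fun j => if j == 0%N then 0 else c j.-1) x).
Proof.
have -> : dsum m (fun j => if j == 0%N then 0 else c j.-1) x =
    \sum_(j < m.+1) c j * (m ^_ j)%:R * ((m - j)%:R * x ^+ (m - j).-1).
  rewrite /dsum big_ord_recl big_ord_recr /= !mul0r add0r subnn mul0r mulr0 addr0.
  by apply: eq_bigr => j _; rewrite ffactnSr subnS natrM !mulrA.
by apply: is_derive_bigsum => j; exact/is_derive_cmul/is_derive_exprn.
Qed.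

Lemma is_derive_dsum_param m (c : R -> nat -> R) dc x (y : R) :
  (forall j, is_derive y 1 (fun s => c s j) (dc j)) ->
  is_derive y 1 (fun s => dsum m (c s) x) (dsum m dc x).
Proof.
by move=> hc; apply: is_derive_bigsum => j; do 2 apply: is_derive_mulc.
Qed.

(** The outermost variable stands for d/dx and the innermost for d/dz, matching the order in which
    [act] reads coefficients. *)
Definition symbol : comNzRingType := {poly {poly {poly R}}}.
Definition sx : symbol := 'X.
Definition sy : symbol := 'X%:P.
Definition sz : symbol := 'X%:P%:P.

Variables m1 m2 m3 : nat.

(** The monomial splits into one-variable factors, hence the nesting; stopping at m1, m2, m3 loses
    nothing, as higher derivatives vanish. *)
Definition act (P : symbol) : R -> R -> R -> R := fun x y z =>
  dsum m1 (fun i => dsum m2 (fun j => dsum m3 (fun k => P`_i`_j`_k) z) y) x.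

Lemma actD P Q x y z : act (P + Q) x y z = act P x y z + act Q x y z.
Proof.
rewrite /act -dsumD; apply: eq_dsum => i; rewrite -dsumD; apply: eq_dsum => j.
by rewrite -dsumD; apply: eq_dsum => k; rewrite !coefD.
Qed.

Lemma act1 : act 1 = @monomial R m1 m2 m3.
Proof.
apply/funext => x; apply/funext => y; apply/funext => z; rewrite /act /monomial.
rewrite -mulrA [RHS]mulrC -(dsum_delta m1 (y ^+ m2 * z ^+ m3)); apply: eq_dsum => i.
rewrite coef1; case: eqP => _; last first.
  by apply: dsum_eq0 => j _; apply: dsum_eq0 => k _; rewrite !coef0.
rewrite [RHS]mulrC -(dsum_delta m2 (z ^+ m3)); apply: eq_dsum => j.
rewrite coef1; case: eqP => _; last first.
  by apply: dsum_eq0 => k _; rewrite !coef0.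
rewrite -[RHS]mul1r -(dsum_delta m3 1); apply: eq_dsum => k.
by rewrite coef1; case: eqP.
Qed.

Lemma is_derive_act_x P (x y z : R) :
  is_derive x 1 (fun s => act P s y z) (act (sx * P) x y z).
Proof.
apply: is_derive_eq (is_derive_dsum _ _ _) _; apply: eq_dsum => i.
rewrite coefXM; case: eqP => // _.
by apply/esym/dsum_eq0 => j _; apply: dsum_eq0 => k _; rewrite !coef0.
Qed.

Lemma is_derive_act_y P (x y z : R) :
  is_derive y 1 (fun s => act P x s z) (act (sy * P) x y z).
Proof.
apply: is_derive_dsum_param => i.
apply: is_derive_eq (is_derive_dsum _ _ _) _; apply: eq_dsum => j.
rewrite coefCM coefXM; case: eqP => // _.
by apply/esym/dsum_eq0 => k _; rewrite !coef0.
Qed.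

Lemma is_derive_act_z P (x y z : R) :
  is_derive z 1 (fun s => act P x y s) (act (sz * P) x y z).
Proof.
apply: is_derive_dsum_param => i; apply: is_derive_dsum_param => j.
apply: is_derive_eq (is_derive_dsum _ _ _) _; apply: eq_dsum => k.
by rewrite !coefCM coefXM.
Qed.

(** Multiplying by [sx], [sy] or [sz] shifts one index by one, so the induction lowers n and i + j +
    k together. *)
Lemma ideal_pow_coef n P i j k : ideal_pow symbol sx sy sz n P -> (i + j + k < n)%N ->
  P`_i`_j`_k = 0.
Proof.
move=> hP; elim: hP i j k => {n P} // n P1 P2 P3 _ I1 _ I2 _ I3 i j k h.
rewrite !coefD /sx /sy /sz !(coefXM, coefCM).
case: i h => [|i] h /=; case: j h => [|j] h /=; case: k h => [|k] h /=;
 rewrite ?coef0 ?I1 ?I2 ?I3 ?addr0 //; lia.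
Qed.

Lemma act_ideal_pow n P x y z : (m1 + m2 + m3 < n)%N -> ideal_pow symbol sx sy sz n P ->
  act P x y z = 0.
Proof.
move=> hn hP; apply: dsum_eq0 => i hi; apply: dsum_eq0 => j hj.
apply: dsum_eq0 => k hk; apply: ideal_pow_coef hP _; lia.
Qed.

End Symbols.

Theorem theorem2p6 (R : realType) (a : R) (ha : a != 0) (m1 m2 m3 : nat) :
  is_solution a (fun t x y z =>
    cos (a * t) * (\sum_(alpha \in [set: multiindex])
       zeta0 a (weight alpha) t * dalpha alpha (monomial m1 m2 m3) x y z)
    - sin (a * t) * (\sum_(alpha \in [set: multiindex])
       zeta1 a (weight alpha) t * dalpha alpha (monomial m1 m2 m3) x y z))
  /\
  is_solution a (fun t x y z =>
    sin (a * t) * (\sum_(alpha \in [set: multiindex])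
       zeta0 a (weight alpha) t * dalpha alpha (monomial m1 m2 m3) x y z)
    + cos (a * t) * (\sum_(alpha \in [set: multiindex])
       zeta1 a (weight alpha) t * dalpha alpha (monomial m1 m2 m3) x y z)).
Proof.
have [dz0 [ddz0 [dz1 [ddz1 [d0 d1 ode0 ode1]]]]] := zeta_ode _ _ ha.
have sol (c s : R -> R) (hc : forall t : R, is_derive t 1 c (a * s t))
    (hs : forall t : R, is_derive t 1 s (- (a * c t))) :=
  is_solution_dalpha R (symbol R) (sx R) (sy R) (sz R) m1 m2 m3 (act R m1 m2 m3)
    (act1 R m1 m2 m3) (actD R m1 m2 m3) (is_derive_act_x R m1 m2 m3)
    (is_derive_act_y R m1 m2 m3) (is_derive_act_z R m1 m2 m3)
    (act_ideal_pow R m1 m2 m3) a c s _ _ _ _ _ _ hc hs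
    (fun n t => (d0 n t).1) (fun n t => (d0 n t).2)
    (fun n t => (d1 n t).1) (fun n t => (d1 n t).2) ode0 ode1.
have hlin (t : R) : is_derive t 1 (fun t => a * t) a.
  by rewrite -[X in is_derive _ _ _ X]mulr1; apply: is_derive_cmul; exact: is_derive_id.
have hcos (t : R) : is_derive t 1 (fun t => cos (a * t)) (- (a * sin (a * t))).
  apply: is_derive_eq (is_derive1_comp (is_derive_cos (a * t)) (hlin t)) _.
  by rewrite mulNr mulrC.
have hsin (t : R) : is_derive t 1 (fun t => sin (a * t)) (a * cos (a * t)).
  apply: is_derive_eq (is_derive1_comp (is_derive_sin (a * t)) (hlin t)) _.
  by rewrite mulrC.
split; last exact: (sol (fun t => sin (a * t)) (fun t => cos (a * t)) hsin hcos).
(* The first function has the same form with c = cos(at) and s = -sin(at), so the sign moves into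
   s. *)
under eq_fun do under eq_fun do under eq_fun do under eq_fun do rewrite -mulNr.
apply: (sol (fun t => cos (a * t)) (fun t => - sin (a * t))) => t.
by rewrite mulrN.
Qed.
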